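(* If $X\sim N(0,A)$ and $A^{-1}$ is a Stieltjes matrix, then $X^0$ is a color process.
   Context: $N(0,A)$ denotes a Gaussian vector with mean zero and covariance matrix $A$ (here an $n\times n$ invertible covariance matrix, $n\ge 1$). A Stieltjes matrix is a symmetric positive definite matrix with nonpositive off-diagonal elements. A $\{0,1\}$-valued process $(Y_i)_{i\in S}$ is a color process (divide and color process) if there are $p\in[0,1]$ and a random partition $\pi$ of $S$ such that $(Y_i)$ has the same law as the process obtained by sampling $\pi$ and then, independently of $\pi$ and independently for different partition elements, assigning all elements of a partition element the value $1$ with probability $p$ and the value $0$ with probability $1-p$. For a random vector $X=(X_i)$, $X^0=(X^0_i)$ with $X^0_i=I(X_i>0)$. *)

(* Defs.v *)
From HB Require Import structures.
From mathcomp Require Import all_boot all_order all_algebra.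
From mathcomp Require Import all_classical all_reals all_analysis.

Set Implicit Arguments.
Unset Strict Implicit.
Unset Printing Implicit Defensive.

Import Order.TTheory GRing.Theory Num.Theory.
Import numFieldNormedType.Exports.

Local Open Scope classical_set_scope.
Local Open Scope ring_scope.

Section Matrices.
Context {R : realType} {n : nat}.
Implicit Type M : 'M[R]_n.

Definition quad_form M (v : 'rV[R]_n) : R := (v *m M *m v^T) 0 0.

Definition covariance_matrix M : Prop :=
  M^T = M /\ forall v, 0 <= quad_form M v.

Definition stieltjes_matrix M : Prop :=
  [/\ M^T = M,
      forall v, v != 0 -> 0 < quad_form M v
    & forall i j, i != j -> M i j <= 0].

End Matrices.

(* Lebesgue measure on R^n, R^n being represented by n-tuples with the product
   (i.e. Borel) sigma-algebra: R^0 is a point of mass 1, and the measure on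
   R^(n+1) is the image of the product of the measures on R and on R^n under
   (x, t) |-> x :: t. The type measurableTypeR R is R with its Borel sets; plain
   R also carries them, but under a display that differs from the one of
   lebesgue_measure. *)
Section LebesgueTuple.
Context {R : realType}.
Local Notation Rn n := (n.-tuple (measurableTypeR R)).

Definition cons_pair n (z : measurableTypeR R * Rn n) : Rn n.+1 :=
  [tuple of z.1 :: z.2].

Lemma measurable_cons_pair n : measurable_fun [set: _] (@cons_pair n).
Proof.
exact: (@measurable_cons _ _ (measurableTypeR R * Rn n)%type _ _ n _
  measurable_fst measurable_snd).
Qed.

Lemma sigma_finite_prod d1 d2 (T1 : measurableType d1) (T2 : measurableType d2)
    (m1 : {sigma_finite_measure set T1 -> \bar R})
    (m2 : {sigma_finite_measure set T2 -> \bar R}) :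
  sigma_finite [set: T1 * T2] (m1 \x m2)%E.
Proof.
have /sigma_finiteP[F [TF ndF Foo]] := sigma_finiteT m1.
have /sigma_finiteP[G [TG ndG Goo]] := sigma_finiteT m2.
exists (fun k => F k `*` G k).
  rewrite -setXTT TF TG; apply/seteqP; split => [[x y] [/= [i _ Fx] [j _ Gy]]|].
    exists (maxn i j) => //; split => /=.
      by move: x Fx; exact/subsetPset/ndF/leq_maxl.
    by move: y Gy; exact/subsetPset/ndG/leq_maxr.
  by move=> [x y] [k _ [/= Fx Gy]]; split; exists k.
move=> k; have [? ?] := Foo k; have [? ?] := Goo k.
split; first exact: measurableX.
by rewrite product_measure1E// lte_mul_pinfty// ge0_fin_numE.
Qed.

Section Step.
Context {n : nat} (m : {sigma_finite_measure set (Rn n) -> \bar R}).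

Definition cons_measure : set (Rn n.+1) -> \bar R :=
  pushforward ((@lebesgue_measure R) \x m)%E (@cons_pair n).

Let cons_measure0 : cons_measure set0 = 0%E.
Proof. by rewrite /cons_measure /pushforward preimage_set0 measure0. Qed.

Let cons_measure_ge0 B : (0 <= cons_measure B)%E.
Proof.
exact: (measure_ge0 ((@lebesgue_measure R) \x m)%E (@cons_pair n @^-1` B)).
Qed.

Let cons_measure_sigma_additive : semi_sigma_additive cons_measure.
Proof.
pose mu : {measure set _ -> \bar R} :=
  measure_function_pushforward__canonical__measure_function_Measure
    ((@lebesgue_measure R) \x m)%E (@measurable_cons_pair n).
exact: (@measure_semi_sigma_additive _ _ _ mu).
Qed.

HB.instance Definition _ := isMeasure.Build _ _ _ cons_measure
  cons_measure0 cons_measure_ge0 cons_measure_sigma_additive.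

Let cons_measure_sigma_finite : sigma_finite [set: _] cons_measure.
Proof.
have : sigma_finite [set: _] ((@lebesgue_measure R) \x m)%E.
  exact: sigma_finite_prod.
move=> [F FT Ffin].
pose split_pair (t : Rn n.+1) : R * Rn n :=
  (thead t, [tuple of behead t]).
have consK : cancel (@cons_pair n) split_pair.
  by move=> [x t]; congr pair; apply/val_inj.
exists (fun k => split_pair @^-1` F k).
  by rewrite -preimage_bigcup -FT preimage_setT.
move=> k; have [mF Foo] := Ffin k; split.
  rewrite -[X in measurable X]setTI.
  have : measurable_fun [set: Rn n.+1] split_pair.
    apply/measurable_fun_pair; first exact: measurable_tnth.
    exact: measurable_behead.
  by apply.
rewrite /cons_measure /pushforward -comp_preimage.
by rewrite (_ : split_pair \o _ = id)//; apply/funext => z /=; rewrite consK.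
Qed.

HB.instance Definition _ :=
  Measure_isSigmaFinite.Build _ _ _ cons_measure cons_measure_sigma_finite.

End Step.

Fixpoint lebesgue_tuple n : {sigma_finite_measure set (Rn n) -> \bar R} :=
  match n with
  | 0 => dirac [tuple]
  | n'.+1 => cons_measure (lebesgue_tuple n')
  end.

End LebesgueTuple.

Section Gaussian.
Context {R : realType}.
Local Notation Rn n := (n.-tuple (measurableTypeR R)).

Definition gauss_pdf n (A : 'M[R]_n) (x : Rn n) : R :=
  expR (- (quad_form (invmx A) (\row_i tnth x i) / 2))
  / Num.sqrt ((2 * pi) ^+ n * \det A).

(* X ~ N(0, A) for an invertible A, for which N(0, A) has a density. *)
Definition gaussian_vector d (T : measurableType d) (P : probability T R)
    n (A : 'M[R]_n) (X : {RV P >-> Rn n}) : Prop :=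
  [/\ covariance_matrix A, A \in unitmx
    & forall B : set (Rn n), measurable B ->
      distribution P X B =
        (\int[lebesgue_tuple n]_(x in B) (gauss_pdf A x)%:E)%E].

End Gaussian.

Section ColorProcess.
Context {R : realType} {S : finType}.

(* A random partition of the finite set S is given by its law mu on the finite
   type of all families of subsets of S, supported on the partitions of S. *)
Definition random_partition (mu : {set {set S}} -> R) : Prop :=
  [/\ forall pa, 0 <= mu pa,
      forall pa, mu pa != 0 -> finset.partition pa [set: S]%SET
    & \sum_(pa : {set {set S}}) mu pa = 1].

(* Probability of the configuration y: pa is sampled from mu, C is the set of
   the blocks of pa that receive the value 1 (independently, each with probability p),
   and i gets the value of its block, pblock pa i. *)
Definition color_law (p : R) (mu : {set {set S}} -> R) (y : S -> bool) : R :=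
  \sum_(pa : {set {set S}})
    mu pa * \sum_(C : {set {set S}} | C \subset pa)
      p ^+ #|C| * (1 - p) ^+ #|pa :\: C| *
      [forall i, y i == (finset.pblock pa i \in C)]%:R.

Definition color_process d (T : measurableType d) (P : probability T R)
    (Y : S -> T -> bool) : Prop :=
  exists (p : R) (mu : {set {set S}} -> R),
    [/\ 0 <= p <= 1, random_partition mu &
        forall y : S -> bool,
          P [set w | forall i, Y i w = y i] = (color_law p mu y)%:E].

End ColorProcess.

Definition threshold0 (R : realType) (T : Type) n
    (X : T -> n.-tuple (measurableTypeR R)) (i : 'I_n) (w : T) : bool :=
  0 < tnth (X w) i.

(* Main.v *)
(* Put J_ij = - M_ij |x_i| |x_j| with M = A^-1.  Given the moduli |x_i|, the
   signs of x have law proportional to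
     prod_(i, j) exp (J_ij s_i s_j / 2),
   a ferromagnetic Ising model since M is a Stieltjes matrix.  As in the
   Fortuin-Kasteleyn representation, write each factor with i <> j as
     exp (- K) + (exp K - exp (- K)) 1_(s_i = s_j),  K = J_ij / 2 >= 0,
   and expand the product: on the orthant with sign pattern y, the density is
   the sum, over the sets E of edges along which y is constant, of nonnegative
   weights depending on |x| only.  The integral of such a weight is the same
   over all orthants, so the law of X^0 is a mixture over E of uniform
   colorings of the components of E, i.e. a color process with p = 1/2. *)
Require Import Defs.
From HB Require Import structures.
From mathcomp Require Import all_boot all_order all_algebra.
From mathcomp Require Import all_classical all_reals all_analysis.
From mathcomp Require Import measurable_realfun ring lra.

Set Implicit Arguments.
Unset Strict Implicit.
Unset Printing Implicit Defensive.

Import Order.TTheory GRing.Theory Num.Theory.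
Import numFieldNormedType.Exports.

Local Open Scope classical_set_scope.
Local Open Scope ring_scope.


(** * Random edge sets and color processes *)

Section ColorFromEdges.
Context {R : realType} {S : finType}.
Implicit Types (E : {set S * S}) (pa C : {set {set S}}) (y : S -> bool).

(** Edges are ordered pairs, as in the double sum of a quadratic form; connectivity ignores their
    orientation, and loops have no effect. *)
Definition components E : {set {set S}} :=
  equivalence_partition
    (connect [rel i j | ((i, j) \in E) || ((j, i) \in E)]) [set: S]%SET.

Definition constant_on_edges E y := [forall e in E, y e.1 == y e.2].

Definition constant_on_blocks pa y :=
  [forall i, forall j, (j \in finset.pblock pa i) ==> (y j == y i)].

Lemma edge_connect_equivalence E :
  {in [set: S]%SET & &, equivalence_rel
    (connect [rel i j | ((i, j) \in E) || ((j, i) \in E)])}.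
Proof.
have sym : connect_sym [rel i j | ((i, j) \in E) || ((j, i) \in E)].
  by apply: sym_connect_sym => i j /=; rewrite orbC.
move=> i j k _ _ _; split=> [|ij]; first exact: connect0.
by apply/idP/idP; apply: connect_trans => //; rewrite sym.
Qed.

Lemma components_partition E : finset.partition (components E) [set: S]%SET.
Proof. exact: equivalence_partitionP (@edge_connect_equivalence E). Qed.

Lemma constant_on_components E y :
  constant_on_blocks (components E) y = constant_on_edges E y.
Proof.
have pbE i j := pblock_equivalence_partition (@edge_connect_equivalence E)
  (finset.in_setT i) (finset.in_setT j).
apply/forallP/forallP => [yE [i j]|yE i].
  apply/implyP => ijE /=; rewrite eq_sym.
  have /forallP/(_ j)/implyP := yE i; apply.
  by rewrite pbE connect1//= ijE.
apply/forallP => j; apply/implyP; rewrite pbE => /connectP[s].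
elim: s i => [i _ ->//|k s IH i /= /andP[ik /IH{}IH] /IH/eqP->].
case/orP: ik => ikE.
  by have /implyP/(_ ikE) := yE (i, k); rewrite eq_sym.
by have /implyP/(_ ikE) := yE (k, i).
Qed.

Lemma half_color_weight (C pa : {set {set S}}) : C \subset pa ->
  2^-1 ^+ #|C| * (1 - 2^-1) ^+ #|pa :\: C| = 2^-1 ^+ #|pa| :> R.
Proof.
move=> Cpa; rewrite (_ : 1 - 2^-1 = 2^-1 :> R); last by field.
by rewrite -exprD -(cardsID C pa) (finset.setIidPr Cpa).
Qed.

(** At p = 1/2 all sets [C] of blocks have the same weight. If [y] is constant on blocks, exactly
    one of them induces [y], namely the blocks on which [y] is true; otherwise none does. *)
Lemma sum_half_colorings pa y : finset.partition pa [set: S]%SET ->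
  \sum_(C : {set {set S}} | C \subset pa)
    (2^-1 : R) ^+ #|C| * (1 - 2^-1) ^+ #|pa :\: C|
      * [forall i, y i == (finset.pblock pa i \in C)]%:R =
  2^-1 ^+ #|pa| * (constant_on_blocks pa y)%:R.
Proof.
move=> part; have [/eqP cov tri npa0] := and3P part.
have pbin i : finset.pblock pa i \in pa by rewrite pblock_mem// cov inE.
have ipb i : i \in finset.pblock pa i by rewrite mem_pblock cov inE.
have [yc|ync] := boolP (constant_on_blocks pa y); last first.
  rewrite mulr0 big1// => C Cpa; case: forallP => [yC|]; last by rewrite mulr0.
  case/negP: ync; apply/forallP => i; apply/forallP => j; apply/implyP => ji.
  by rewrite (eqP (yC i)) (eqP (yC j)) (same_pblock tri ji).
pose C0 := [set B in pa | [exists i in B, y i]]%SET.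
have C0pa : C0 \subset pa by apply/fintype.subsetP => B; rewrite inE => /andP[].
have C0y i : (finset.pblock pa i \in C0) = y i.
  rewrite inE pbin/=; apply/existsP/idP => [[j /andP[ji yj]]|yi].
    by have /forallP/(_ j)/implyP/(_ ji)/eqP <- := forallP yc i.
  by exists i; rewrite ipb.
rewrite (bigD1 C0)//= half_color_weight// big1 ?addr0.
  by congr (_ * _%:R); apply/eqP; rewrite eqb1; apply/forallP => i; rewrite C0y.
move=> C /andP[Cpa /eqP CC0]; case: forallP => [yC|]; last by rewrite mulr0.
case: CC0; apply/setP => B; case: (boolP (B \in pa)) => [Bpa|nBpa]; last first.
  by rewrite (contraNF (fintype.subsetP Cpa B))// (contraNF (fintype.subsetP C0pa B)).
have /set0Pn[i iB] : B != finset.set0 by apply: contraNneq npa0 => <-.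
by rewrite -(def_pblock tri Bpa iB) C0y (eqP (yC i)).
Qed.

(** For fixed [pa] and [C] exactly one coloring arises, and the [2 ^+ #|pa|] choices of [C] have
    equal weight. This serves to compute the total mass of [mu] below. *)
Lemma sum_color_law (mu : {set {set S}} -> R) :
  \sum_(y : {ffun S -> bool}) color_law 2^-1 mu y = \sum_pa mu pa.
Proof.
rewrite /color_law exchange_big/=; apply: eq_bigr => pa _.
rewrite -mulr_sumr exchange_big/= -[RHS]mulr1; congr (_ * _).
transitivity (\sum_(C in powerset pa) (2^-1 : R) ^+ #|pa|).
  apply: eq_big => [C|C Cpa]; first by rewrite powersetE.
  rewrite -mulr_sumr half_color_weight// (bigD1 [ffun i => finset.pblock pa i \in C])//=.
  rewrite big1 ?addr0 => [|y yC].
    rewrite (_ : [forall i, _] = true) ?mulr1//.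
    by apply/forallP => i; rewrite ffunE.
  case: forallP => // yC'; case/eqP: yC; apply/ffunP => i.
  by rewrite ffunE; exact/eqP.
by rewrite sumr_const card_powerset -[LHS]mulr_natr natrX -exprMn mulVf ?expr1n.
Qed.

(* Independent fair colors of the components of E produce each coloring that is
   constant on edges with probability 2 ^ (- number of components), whence the
   factor 2 ^+ #|pa| in the law mu of the partition. *)
Lemma color_process_of_edge_weights d (T : measurableType d)
    (P : probability T R) (Y : S -> T -> bool) (W : {set S * S} -> R) :
  (forall E, 0 <= W E) ->
  (forall y, measurable [set w | forall i, Y i w = y i]) ->
  (forall y, P [set w | forall i, Y i w = y i] =
     (\sum_E W E * (constant_on_edges E y)%:R)%:E) ->
  color_process P Y.
Proof.
move=> W0 mY PY.
pose mu pa := \sum_(E | components E == pa) W E * 2 ^+ #|pa|.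
have supp pa : mu pa != 0 -> finset.partition pa [set: S]%SET.
  apply: contra_neqT => npa; apply: big1 => E /eqP Epa.
  by case/negP: npa; rewrite -Epa components_partition.
have lawE y : P [set w | forall i, Y i w = y i] = (color_law 2^-1 mu y)%:E.
  rewrite PY; congr EFin; rewrite (partition_big components predT)//=.
  apply: eq_bigr => pa _.
  (* If [mu pa] vanishes, [pa] need not be a partition, but then every [W E] that contributes to it
     is 0, by nonnegativity. *)
  have [mu0|/supp part] := eqVneq (mu pa) 0; last first.
    rewrite sum_half_colorings// mulr_suml.
    apply: eq_bigr => E /eqP <-; rewrite constant_on_components.
    by rewrite mulrA -[W E * _ * _]mulrA -exprMn mulfV ?expr1n ?mulr1.
  rewrite mu0 mul0r big1// => E Epa.
  have W2 F : components F == pa -> 0 <= W F * 2 ^+ #|pa|.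
    by move=> _; rewrite mulr_ge0 ?exprn_ge0.
  have /eqP := psumr_eq0P W2 mu0 Epa.
  by rewrite mulf_eq0 expf_eq0 pnatr_eq0 andbF orbF => /eqP ->; rewrite mul0r.
exists 2^-1, mu; split => //; first by lra.
split=> // [pa|]; first by apply: sumr_ge0 => E _; rewrite mulr_ge0// exprn_ge0.
(* The mass of [mu] is the sum of the probabilities of all configurations of [Y], which are disjoint
   events covering the space. *)
rewrite -sum_color_law; apply: EFin_inj; rewrite -sumEFin.
under eq_bigr do rewrite -lawE.
have fsE : \sum_(y \in [set: {ffun S -> bool}]) P [set w | forall i, Y i w = y i]
    = \sum_(y : {ffun S -> bool}) P [set w | forall i, Y i w = y i].
  rewrite [RHS]fsbig_seq ?index_enum_uniq//; congr (\sum_(y \in _) _)%E.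
  by apply/seteqP; split => y //= _; rewrite mem_index_enum.
rewrite -fsE -measure_fin_bigcup//=; last first.
  move=> y z _ _ [w [/= yw zw]]; apply/ffunP => i; rewrite -yw; exact: zw.
rewrite -[RHS](@probability_setT _ _ _ P); congr (P _).
rewrite -subTset => w _; exists [ffun i => Y i w] => //= i.
by rewrite ffunE.
Qed.

End ColorFromEdges.

(** * Reflections and integrals over orthants *)

Section Orthants.
Context {R : realType}.
Local Notation mR := (measurableTypeR R).
Local Notation mu := (@lebesgue_measure R).
Local Notation Rn n := (n.-tuple mR).

Lemma measurable_opp_mR : measurable_fun [set: mR] (-%R : mR -> mR).
Proof. exact: oppr_measurable. Qed.

(** By uniqueness of Lebesgue measure, half-open intervals suffice: []a, b]] is reflected to [[-b,
    -a[], which has the same length. *)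
Lemma lebesgue_measure_opp (B : set mR) : measurable B -> mu (-%R @^-1` B) = mu B.
Proof.
move=> mB; apply/esym.
pose nu : {measure set mR -> \bar R} :=
  measure_function_pushforward__canonical__measure_function_Measure
    mu measurable_opp_mR.
apply: (@lebesgue_measure_unique _ nu) => // X [[a b] /= _ <-].
rewrite /nu/= /pushforward.
rewrite (_ : _ @^-1` _ = `[- b, - a[%classic); last first.
  by apply/seteqP; split => x /=; rewrite !in_itv/= lerNl ltrNr andbC.
by rewrite !lebesgue_measure_itv/= !lte_fin ltrN2 -!EFinB opprK addrC.
Qed.

Lemma measurable_integral_section d1 d2 (T1 : measurableType d1)
    (T2 : measurableType d2) (m : {sigma_finite_measure set T2 -> \bar R})
    (D : set T2) (f : T1 * T2 -> \bar R) :
  measurable D -> measurable_fun setT f -> (forall z, 0 <= f z)%E ->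
  measurable_fun setT (fun x => \int[m]_(y in D) f (x, y))%E.
Proof.
move=> mD mf f0.
have mXD : measurable ([set: T1] `*` D) by exact: measurableX.
rewrite (_ : (fun x => _) = fubini_F m (f \_ (setT `*` D))).
  apply: measurable_fun_fubini_tonelli_F.
    by apply: (measurable_restrictT _ mXD).1; exact: measurable_funTS.
  by move=> z; rewrite patchE; case: ifP.
apply/funext => x; rewrite /fubini_F [LHS]integral_mkcond.
by apply: eq_integral => y _; rewrite !patchE in_setX in_setT.
Qed.

(** The point 0 belongs to [half_line false], in accordance with the strict threshold. *)
Definition half_line (b : bool) : set mR := [set x | (0 < x) = b].

Lemma measurable_half_line b : measurable (half_line b).
Proof.
have m0 : measurable (half_line true).
  by rewrite (_ : half_line _ = `]0, +oo[%classic)//; rewrite set_itvE.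
case: b => //; rewrite (_ : half_line _ = ~` half_line true); first exact: measurableC.
by apply/seteqP; split => x; rewrite /half_line/=; [move=> -> | move/negP/negbTE].
Qed.

Lemma integral_half_line (G : mR -> \bar R) (b b' : bool) :
  measurable_fun setT G -> (forall x, 0 <= G x)%E -> (forall x, G (- x) = G x) ->
  (\int[mu]_(x in half_line b) G x = \int[mu]_(x in half_line b') G x)%E.
Proof.
move=> mG G0 Gopp.
suff E : (\int[mu]_(x in half_line false) G x = \int[mu]_(x in half_line true) G x)%E.
  by case: b; case: b'; rewrite ?E.
pose nu : {measure set mR -> \bar R} :=
  measure_function_pushforward__canonical__measure_function_Measure
    mu measurable_opp_mR.
have -> : half_line true = `]0, +oo[%classic by rewrite set_itvE.
have -> : half_line false = `]-oo, 0]%classic.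
  rewrite set_itvE.
  by apply/seteqP; split => x; rewrite /half_line/= leNgt; [move=> -> | move/negbTE].
(* The null point 0 is dropped, so that the reflection exchanges the two open half-lines. *)
rewrite -integral_itv_bndo_bndc; last exact: measurable_funTS.
rewrite (@eq_measure_integral _ _ _ _ nu); last first.
  by move=> B mB _; rewrite /nu/= /pushforward lebesgue_measure_opp.
rewrite ge0_integral_pushforward//; [|exact: measurable_funTS].
rewrite (_ : _ @^-1` _ = `]0, +oo[%classic); last first.
  by apply/seteqP; split => x /=; rewrite !in_itv/= andbT oppr_lt0.
by apply: eq_integral => x _ /=.
Qed.

(** Change of variables along [cons_pair], then Tonelli. *)
Lemma integral_lebesgue_tupleS n (f : Rn n.+1 -> \bar R) :
  measurable_fun setT f -> (forall x, 0 <= f x)%E ->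
  (\int[lebesgue_tuple n.+1]_x f x =
   \int[mu]_x \int[lebesgue_tuple n]_t f [tuple of x :: t])%E.
Proof.
move=> mf f0.
pose nu : {measure set (Rn n.+1) -> \bar R} :=
  measure_function_pushforward__canonical__measure_function_Measure
    (mu \x lebesgue_tuple n)%E (@measurable_cons_pair R n).
rewrite (@eq_measure_integral _ _ _ _ nu)//.
rewrite ge0_integral_pushforward//; last exact: measurable_cons_pair.
rewrite preimage_setT fubini_tonelli1//.
  exact: measurableT_comp (@measurable_cons_pair R n).
by move=> z; exact: f0.
Qed.

Definition orthant n (y : 'I_n -> bool) : set (Rn n) :=
  [set x | forall i, (0 < tnth x i) = y i].

Lemma measurable_orthant n (y : 'I_n -> bool) : measurable (orthant y).
Proof.
rewrite (_ : orthant y = \bigcap_(i : 'I_n) ((tnth (T := mR))^~ i @^-1` half_line (y i))).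
  apply: fin_bigcap_measurable => // i _; rewrite -[X in measurable X]setTI.
  exact: measurable_tnth (measurable_half_line _).
by apply/seteqP; split => x xy i => [_|]; [exact: xy | exact: (xy i)].
Qed.

(** Induction on the dimension: the integral [G] over the last n coordinates does not depend on
    their signs by induction, and it is even in the first coordinate, so [integral_half_line]
    handles the remaining sign. *)
Lemma integral_orthant n (f : Rn n -> \bar R) (y y' : 'I_n -> bool) :
  measurable_fun setT f -> (forall x, 0 <= f x)%E ->
  (forall x x', (forall i, `|tnth x i| = `|tnth x' i|) -> f x = f x') ->
  (\int[lebesgue_tuple n]_(x in orthant y) f x =
   \int[lebesgue_tuple n]_(x in orthant y') f x)%E.
Proof.
elim: n f y y' => [f y y' _ _ _|n IH f y y' mf f0 fabs].
  by congr (integral _ _ _); apply/seteqP; split => x _ [].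
have mfc : measurable_fun setT (fun z : mR * Rn n => f [tuple of z.1 :: z.2]).
  exact: measurableT_comp (@measurable_cons_pair R n).
pose G (z : 'I_n -> bool) (x : mR) :=
  (\int[lebesgue_tuple n]_(t in orthant z) f [tuple of x :: t])%E.
have G0 z x : (0 <= G z x)%E by exact: integral_ge0.
have mG z : measurable_fun setT (G z).
  exact: (measurable_integral_section _ (measurable_orthant z) mfc).
have Gopp z x : G z (- x) = G z x.
  apply: eq_integral => t _; apply: fabs => i.
  by rewrite !(tnth_nth 0)/=; case: i => -[|i]//= _; rewrite normrN.
have GG z z' x : G z x = G z' x.
  apply: IH => //; first exact: measurableT_comp mfc (pair1_measurable x).
  move=> t t' tt'; apply: fabs => i.
  case: (unliftP ord0 i) => [j|] ->; first by rewrite !tnthS.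
  by rewrite !tnth0.
have step (w : 'I_n.+1 -> bool) :
    (\int[lebesgue_tuple n.+1]_(x in orthant w) f x =
     \int[mu]_(x in half_line (w ord0)) G (fun i => w (lift ord0 i)) x)%E.
  rewrite integral_mkcond integral_lebesgue_tupleS; last 2 first.
  - apply: (measurable_restrictT _ (measurable_orthant _)).1.
    exact: measurable_funTS.
  - by move=> x; rewrite patchE; case: ifP.
  rewrite [RHS]integral_mkcond; apply: eq_integral => x _.
  rewrite patchE; case: ifPn => xw.
    rewrite /G [RHS]integral_mkcond; apply: eq_integral => t _.
    rewrite !patchE; congr (if _ then _ else _).
    move: xw; rewrite inE/= => xw.
    apply/idP/idP; rewrite !inE/= => h i.
      by rewrite -h tnthS.
    case: (unliftP ord0 i) => [j|] ->; first by rewrite tnthS h.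
    by rewrite tnth0.
  rewrite integral0_eq// => t _; rewrite patchE; case: ifPn => //.
  rewrite inE => /(_ ord0); rewrite tnth0 => xw'.
  by move/negP: xw; rewrite inE.
rewrite !step; under eq_integral do rewrite (GG _ (fun i => y' (lift ord0 i))).
exact: integral_half_line.
Qed.

End Orthants.

(** * Expansion of the Gaussian density over edge sets *)

Section GaussianExpansion.
Context {R : realType} {n : nat} (A : 'M[R]_n).
Local Notation Rn := (n.-tuple (measurableTypeR R)).
Local Notation M := (invmx A).
Implicit Types (e : 'I_n * 'I_n) (E : {set 'I_n * 'I_n}) (x : Rn).

(** This is K in the expansion. A pair of distinct indices gives two edges, one for each order. *)
Definition coupling e x : R :=
  - (M e.1 e.2 * (`|tnth x e.1| * `|tnth x e.2|)) / 2.

(* A diagonal factor does not depend on the signs, and its coupling is negative: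
   it goes undivided into the open weight, which keeps both weights nonnegative. *)
Definition closed_weight e x : R :=
  if e.1 == e.2 then 0 else expR (- coupling e x).

Definition open_weight e x : R := expR (coupling e x) - closed_weight e x.

Definition edge_weight E x : R :=
  (\prod_e if e \in E then open_weight e x else closed_weight e x)
  / Num.sqrt ((2 * pi) ^+ n * \det A).

(** Off the diagonal K >= 0, hence exp K >= exp (- K); on the diagonal the weights are exp K and
    0. *)
Lemma edge_weight_ge0 E x : (forall i j, i != j -> M i j <= 0) ->
  0 <= edge_weight E x.
Proof.
move=> offdiag; apply: mulr_ge0; last by rewrite invr_ge0 sqrtr_ge0.
apply: prodr_ge0 => e _; rewrite /open_weight /closed_weight.
case: ifP => _; case: eqP => [_|/eqP e12]; rewrite ?subr0 ?expR_ge0//.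
rewrite subr_ge0 ler_expR -subr_ge0 opprK addr_ge0// /coupling divr_ge0// oppr_ge0.
all: by rewrite mulr_le0_ge0 ?offdiag// mulr_ge0.
Qed.

Lemma measurable_edge_weight E : measurable_fun setT (edge_weight E).
Proof.
have mc e : measurable_fun setT (coupling e).
  apply: measurable_funM => //; apply: measurableT_comp => //.
  apply: measurable_funM => //; apply: measurable_funM.
    by apply: measurableT_comp => //; exact: measurable_tnth.
  by apply: measurableT_comp => //; exact: measurable_tnth.
have me e : measurable_fun setT (fun x => expR (coupling e x)).
  exact: measurableT_comp.
have mz e : measurable_fun setT (closed_weight e).
  rewrite /closed_weight; case: eqP => _ //.
  apply: measurableT_comp => //; exact: measurableT_comp.
apply: measurable_funM => //; apply: measurable_prod => e _.
by case: (e \in E); [exact: measurable_funB (me e) (mz e) | exact: mz].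
Qed.

Lemma edge_weight_abs E x x' : (forall i, `|tnth x i| = `|tnth x' i|) ->
  edge_weight E x = edge_weight E x'.
Proof.
move=> xx'; congr (_ / _); apply: eq_bigr => e _.
by rewrite /open_weight /closed_weight /coupling !xx'.
Qed.

Lemma quad_formE (B : 'M[R]_n) (v : 'rV[R]_n) :
  quad_form B v = \sum_e B e.1 e.2 * (v 0 e.1 * v 0 e.2).
Proof.
rewrite -(pair_big predT predT (fun i j => B i j * (v 0 i * v 0 j)))/= exchange_big/=.
rewrite /quad_form mxE; apply: eq_bigr => j _; rewrite !mxE mulr_suml.
by apply: eq_bigr => i _; ring.
Qed.

Lemma gauss_pdf_orthant (y : 'I_n -> bool) x : orthant y x ->
  gauss_pdf A x = \sum_E edge_weight E x * (constant_on_edges E y)%:R.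
Proof.
move=> xy; rewrite /gauss_pdf quad_formE -mulNr -sumrN mulr_suml expR_sum.
(* On the orthant the exponent of this factor is K if the two signs agree and - K otherwise; on the
   diagonal they always agree. *)
have pairE e : expR (- (M e.1 e.2 * ((\row_i tnth x i) 0 e.1 * (\row_i tnth x i) 0 e.2)) / 2)
    = open_weight e x * (y e.1 == y e.2)%:R + closed_weight e x.
  have abs i : tnth x i = (if y i then 1 else -1) * `|tnth x i|.
    rewrite -xy; case: ltP => [?|?]; first by rewrite mul1r gtr0_norm.
    by rewrite ler0_norm// mulN1r opprK.
  have -> : (\row_i tnth x i) 0 e.1 * (\row_i tnth x i) 0 e.2 =
      (if y e.1 == y e.2 then 1 else -1) * (`|tnth x e.1| * `|tnth x e.2|).
    rewrite !mxE [LHS](congr2 *%R (abs e.1) (abs e.2)).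
    by case: (y e.1); case: (y e.2); rewrite /=; ring.
  rewrite /open_weight /closed_weight /coupling.
  case: (eqVneq e.1 e.2) => [->|_]; first by rewrite eqxx subr0 addr0 mulr1 mul1r.
  case: eqP => _; first by rewrite mulr1 subrK mul1r.
  by rewrite mulr0 add0r; congr expR; ring.
under eq_bigr do rewrite pairE.
(* Distributivity: [E] is the set of pairs for which the open term is chosen. *)
rewrite bigA_distr/= mulr_suml; apply: eq_bigr => E _.
rewrite /edge_weight mulrAC; congr (_ / _).
rewrite (_ : (constant_on_edges E y)%:R =
    \prod_e (if e \in E then (y e.1 == y e.2)%:R else 1) :> R).
  by rewrite -big_split/=; apply: eq_bigr => e _; case: ifP; rewrite ?mulr1.
rewrite -big_mkcond/=.
have [/forallP yE|/forallPn[e]] := boolP (constant_on_edges E y).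
  by rewrite big1// => e eE; rewrite (implyP (yE e) eE).
rewrite negb_imply => /andP[eE /negbTE ye].
by rewrite (bigD1 e)//= ye mul0r.
Qed.

(** The edge weights depend on moduli only, so their integrals can be moved to the positive orthant;
    [y] then enters only through the constancy indicators. *)
Lemma integral_gauss_pdf_orthant (y : 'I_n -> bool) :
  (forall i j, i != j -> M i j <= 0) ->
  (\int[lebesgue_tuple n]_(x in orthant y) (gauss_pdf A x)%:E =
   \sum_E (\int[lebesgue_tuple n]_(x in orthant (fun=> true)) (edge_weight E x)%:E) *
     (constant_on_edges E y)%:R%:E)%E.
Proof.
move=> offdiag.
under eq_integral => x xy.
  rewrite (@gauss_pdf_orthant y) -?sumEFin; last by rewrite inE in xy.
  over.
rewrite ge0_integral_sum//=; last 3 first.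
- exact: measurable_orthant.
- move=> E; apply/measurable_EFinP; apply: measurable_funM => //.
  by apply: measurable_funTS; exact: measurable_edge_weight.
- by move=> E x _; rewrite lee_fin mulr_ge0 ?edge_weight_ge0.
apply: eq_bigr => E _; under eq_integral do rewrite EFinM.
rewrite ge0_integralZr//; last 3 first.
- exact: measurable_orthant.
- apply/measurable_EFinP; apply: measurable_funTS; exact: measurable_edge_weight.
- by move=> x _; rewrite lee_fin edge_weight_ge0.
congr (_ * _)%E; apply: integral_orthant.
- apply/measurable_EFinP; exact: measurable_edge_weight.
- by move=> x; rewrite lee_fin edge_weight_ge0.
- by move=> x x' xx'; rewrite (edge_weight_abs _ xx').
Qed.

End GaussianExpansion.

(** * Law of the signs of a Gaussian vector *)

Theorem theorem2p2 (R : realType) (d : measure_display) (T : measurableType d)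
    (P : probability T R) (n : nat) (hn : (1 <= n)%N) (A : 'M[R]_n)
    (X : {RV P >-> n.-tuple (measurableTypeR R)}) :
  gaussian_vector A X -> stieltjes_matrix (invmx A) ->
  color_process P (threshold0 X).
Proof.
move=> [_ _ distX] [_ _ offdiag].
pose I E := (\int[lebesgue_tuple n]_(x in orthant (fun=> true)) (edge_weight A E x)%:E)%E.
have I0 E : (0 <= I E)%E.
  by apply: integral_ge0 => x _; rewrite lee_fin edge_weight_ge0.
have PX y : P [set w | forall i, threshold0 X i w = y i] =
    (\sum_E I E * (constant_on_edges E y)%:R%:E)%E.
  rewrite -integral_gauss_pdf_orthant// -distX//; exact: measurable_orthant.
(* The all-true pattern is constant on every edge set, so [I E] is one of the nonnegative terms that
   add up to the probability of the positive orthant, which is at most 1. *)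
have Ifin E : I E \is a fin_num.
  rewrite ge0_fin_numE//; apply: le_lt_trans (ltry 1).
  apply: le_trans (probability_le1 P _); last first.
    exact: (measurable_funPTI X (measurable_orthant (fun=> true))).
  rewrite [leRHS](PX (fun=> true)) (bigD1 E)//=.
  rewrite (_ : constant_on_edges E _ = true) ?mule1; last first.
    by apply/forallP => e; apply/implyP.
  by rewrite leeDl// sume_ge0// => F _; rewrite mule_ge0.
apply: (@color_process_of_edge_weights _ _ _ _ _ _ (fun E => fine (I E))) => [E|y|y].
- exact: fine_ge0.
- exact: (measurable_funPTI X (measurable_orthant y)).
- by rewrite PX -sumEFin; apply: eq_bigr => E _; rewrite EFinM fineK.
Qed.
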